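(* Let $R$ be a commutative Noetherian local ring of prime characteristic $p>0$, let $P\in\mathrm{Spec}(R)$ be a perfect prime ideal of finite projective dimension $t$ (so $t=\mathrm{pd}_R(R/P)$ equals the grade $g=\mathrm{grade}(P,R)$), and let $q:=p^n$. Suppose one of the following holds: (i) $\beta_{t-1}(R/P)-\beta_t(R/P)+1=\mathrm{grade}(P,R)$; (ii) $\beta_t(R/P)=\beta_{t-1}(R/P)$; (iii) $\beta_t(R/P)=1$. Then $D(P^{[q]})=P^{[q]}$.
   Context: $\beta_i(M)$ denotes the $i$-th Betti number of $M$, i.e. the rank of the $i$-th module in a minimal free resolution of $M$. An ideal $P$ is perfect if $\mathrm{pd}_R(R/P)=\mathrm{grade}(P,R)$. For $q=p^n$, $P^{[q]}$ is the ideal generated by $\{x^q : x\in P\}$. For an ideal $J$ of grade $g$, $D(J):=\mathrm{Ann}_R(\mathrm{Ext}^g_R(R/J,R))$. *)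

(* Defs.v *)
From HB Require Import structures.
From mathcomp Require Import all_boot all_order all_algebra.
From mathcomp Require Import boolp classical_sets.
Set Implicit Arguments.
Unset Strict Implicit.
Unset Printing Implicit Defensive.
Import GRing.Theory.
Local Open Scope ring_scope.

(* Submodules of V are the library's submodClosed V, and ideals
   of a commutative ring R are submodClosed R^o; they need not be proper. *)
Notation ideal R := (submodClosed (GRing.regular R)).

Section QuotientModule.
Variables (R : comNzRingType) (V : lmodType R) (N : submodClosed V).

(* The library's quotient of a Z-module needs a zmodClosed predicate, which
   submodClosed does not provide. *)
Definition submod_pred : {pred V} := fun x => x \in N.

Fact submod_pred_zmod_closed : GRing.zmod_closed submod_pred.
Proof. exact: GRing.submod_closedB (submodClosedP N). Qed.

HB.instance Definition _ :=
  GRing.isZmodClosed.Build V submod_pred submod_pred_zmod_closed.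

Definition quotmod : Type := Quotient.quot submod_pred.
HB.instance Definition _ := GRing.Zmodule.on quotmod.

Definition quotmod_pi (x : V) : quotmod := (\pi_quotmod x)%qT.

Lemma quotmod_piP x y : quotmod_pi x = quotmod_pi y <-> x - y \in N.
Proof.
rewrite -[_ \in N]/(x - y \in submod_pred) Quotient.idealrBE.
by split=> [/eqP|/eqP].
Qed.

Lemma quotmod_pi_surj (u : quotmod) : exists x, quotmod_pi x = u.
Proof. by exists (repr u); apply: reprK. Qed.

Fact quotmod_piB : {morph quotmod_pi : x y / x - y}.
Proof. exact: (raddfB \pi_(Quotient.quot submod_pred)%qT). Qed.

Fact quotmod_piD : {morph quotmod_pi : x y / x + y}.
Proof. exact: (raddfD \pi_(Quotient.quot submod_pred)%qT). Qed.

Definition quotmod_scale (a : R) (u : quotmod) : quotmod :=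
  quotmod_pi (a *: (repr u : V)).

Lemma quotmod_pi_scale a x :
  quotmod_scale a (quotmod_pi x) = quotmod_pi (a *: x).
Proof.
apply/quotmod_piP; rewrite -scalerBr; apply: rpredZ.
by apply/quotmod_piP; apply: reprK.
Qed.

Fact quotmod_scalerA a b u :
  quotmod_scale a (quotmod_scale b u) = quotmod_scale (a * b) u.
Proof.
by have [x <-] := quotmod_pi_surj u; rewrite !quotmod_pi_scale scalerA.
Qed.

Fact quotmod_scale1r : left_id 1 quotmod_scale.
Proof.
by move=> u; have [x <-] := quotmod_pi_surj u; rewrite quotmod_pi_scale scale1r.
Qed.

Fact quotmod_scalerDr : right_distributive quotmod_scale +%R.
Proof.
move=> a u v; have [x <-] := quotmod_pi_surj u; have [y <-] := quotmod_pi_surj v.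
by rewrite -quotmod_piD !quotmod_pi_scale -quotmod_piD scalerDr.
Qed.

Fact quotmod_scalerDl u : {morph quotmod_scale^~ u : a b / a + b}.
Proof.
move=> a b; have [x <-] := quotmod_pi_surj u.
by rewrite !quotmod_pi_scale -quotmod_piD scalerDl.
Qed.

HB.instance Definition _ := GRing.Zmodule_isLmodule.Build R quotmod
  quotmod_scalerA quotmod_scale1r quotmod_scalerDr quotmod_scalerDl.

End QuotientModule.

Section Span.
Variables (R : comNzRingType) (V : lmodType R) (S : set V).

Definition span_submod : {pred V} := fun v =>
  `[< forall N : submodClosed V, (forall x, S x -> x \in N) -> v \in N >].

Fact span_submod_closed : GRing.submod_closed span_submod.
Proof.
split=> [|a u v /asboolP Su /asboolP Sv]; apply/asboolP => N SN.
  exact: rpred0.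
by apply: rpredD; [apply: rpredZ; apply: Su | apply: Sv].
Qed.

HB.instance Definition _ := GRing.isSubmodClosed.Build R V span_submod
  (GRing.submod_closed_semi span_submod_closed).

End Span.

Section Ideals.
Variable R : comNzRingType.
Implicit Types (I J P m : ideal R) (s : seq R).

Definition ideal_span (S : set R) : ideal R := span_submod (S : set R^o).

Definition noetherian :=
  forall I, exists s, I =i ideal_span (fun x => x \in s).

Definition maximal_ideal m :=
  1 \notin m /\ forall J, {subset m <= J} -> 1 \notin J -> J =i m.

Definition local_ring :=
  exists2 m, maximal_ideal m & forall m', maximal_ideal m' -> m' =i m.

Definition prime_ideal P := 1 \notin P /\ prime_idealr_closed (P : {pred R}).

Definition frobenius_power I (q : nat) : ideal R :=
  ideal_span (fun y => exists2 x, x \in I & y = x ^+ q).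

(* s`_i is a nonzerodivisor modulo (s_0, .., s_(i-1)), and R/(s) is nonzero. *)
Definition regular_seq s :=
  (forall i (r : R), (i < size s)%N ->
     r * s`_i \in ideal_span (fun x => x \in take i s) ->
     r \in ideal_span (fun x => x \in take i s))
  /\ 1 \notin ideal_span (fun x => x \in s).

(* grade(I, R) = g *)
Definition has_grade I (g : nat) :=
  (exists s, [/\ regular_seq s, {subset s <= I} & size s = g]) /\
  forall s, regular_seq s -> {subset s <= I} -> (size s <= g)%N.

End Ideals.

Section Resolutions.
Variables (R : comNzRingType) (M : lmodType R).

(* Exact complexes ... -> Q 1 -> Q 0 -> M -> 0; res_d i : Q (i + 1) -> Q i. *)
Record resolution (Q : nat -> lmodType R) := Resolution {
  res_d : forall i, {linear Q i.+1 -> Q i};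
  res_aug : {linear Q 0%N -> M};
  res_aug_surj : forall y, exists x, res_aug x = y;
  res_exact0 : forall x, res_aug x = 0 <-> exists y, res_d 0 y = x;
  res_exact : forall i (x : Q i.+1),
    res_d i x = 0 <-> exists y, res_d i.+1 y = x
}.

Definition projective (Q : lmodType R) :=
  forall (A B : lmodType R) (g : {linear A -> B}) (f : {linear Q -> B}),
    (forall b, exists a, g a = b) ->
    exists h : {linear Q -> A}, forall x, g (h x) = f x.

Definition has_proj_resolution_of_length (t : nat) :=
  exists (Q : nat -> lmodType R) (_ : resolution Q),
    (forall i, projective (Q i)) /\
    (forall i, (t < i)%N -> forall x : Q i, x = 0).

(* pd_R(M) = t, for M nonzero *)
Definition has_pd (t : nat) :=
  has_proj_resolution_of_length t /\
  forall u, has_proj_resolution_of_length u -> (t <= u)%N.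

(* The differentials have image in m F, m the maximal ideal of the local ring R. *)
Definition minimal (r : nat -> nat)
    (F : resolution (fun i => 'rV[R]_(r i) : lmodType R)) :=
  forall m : ideal R, maximal_ideal m ->
  forall i (x : 'rV[R]_(r i.+1)) j, (res_d F i x : 'rV[R]_(r i)) 0 j \in m.

(* The i-th Betti number over a local ring. It is 0 for i < 0, and also, as a
   default value, when M has no resolution by finite free modules that is minimal
   (which cannot happen for M finite over a Noetherian local ring). *)
Definition betti (i : int) : nat :=
  if i is Posz n then
    xget 0%N (fun b => exists (r : nat -> nat)
      (F : resolution (fun j => 'rV[R]_(r j) : lmodType R)),
      minimal F /\ r n = b)
  else 0%N.

Section Cohomology.
Variables (N : lmodType R) (Q : nat -> lmodType R) (F : resolution Q).

Definition cocycle i (f : Q i -> N) := forall x, f (res_d F i x) = 0.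

Definition coboundary i : (Q i -> N) -> Prop :=
  match i return (Q i -> N) -> Prop with
  | 0 => fun f => forall x, f x = 0
  | j.+1 => fun f => exists h : {linear Q j -> N}, forall x, f x = h (res_d F j x)
  end.

End Cohomology.

(* Ann_R(Ext^i_R(M, N)): the annihilator of H^i(Hom(Q, N)) for a projective
   resolution Q of M. By the comparison theorem it does not depend on Q. *)
Definition ann_Ext (i : nat) (N : lmodType R) : set R := fun a =>
  exists (Q : nat -> lmodType R) (F : resolution Q),
    (forall j, projective (Q j)) /\
    forall f : {linear Q i -> N}, cocycle F f ->
      coboundary F (fun x => a *: f x).

End Resolutions.

Section Perfection.
Variable R : comNzRingType.

Definition cyclic_module (I : ideal R) : lmodType R := quotmod I.

Definition perfect_ideal (P : ideal R) :=
  exists2 t, has_pd (cyclic_module P) t & has_grade P t.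

(* D(J), with g = grade(J, R); empty if J has no grade, i.e. if J = R. *)
Definition annExt_grade (J : ideal R) : set R := fun a =>
  exists2 g, has_grade J g & ann_Ext (cyclic_module J) g R^o a.

End Perfection.

(* Main.v *)
Require Import Defs.
From mathcomp Require Import all_boot all_order all_algebra.
From mathcomp Require Import boolp classical_sets.
From HB Require Import structures.
Import GRing.Theory.
Set Implicit Arguments.
Unset Strict Implicit.
Unset Printing Implicit Defensive.
Local Open Scope ring_scope.

(** Why the theorem holds.  Let [M] be a perfect module of grade [t].  Then
    [Ext^t(M, R)] is perfect of grade [t] too, and its own [Ext^t] gives [M]
    back, so that [M] and [Ext^t(M, R)] have the same annihilator.  For
    [M = R/J] with [J = P^[q]] this is [D(J) = J], once [R/J] is known to be
    perfect of grade [t], which is the theorem of Peskine and Szpiro on the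
    Frobenius functor.  The proof makes both facts explicit on matrices.

    Take a resolution of [R/P] by finite free modules, with matrices [D i].
    That [P] kills [R/P], and that [R/P] has projective dimension at most [t],
    are recorded by matrix identities: a null-homotopy [x = dh + hd] for each
    [x] in [P] ([resolves_null_homotopic]), and a contraction [1 = dh + hd] in
    every degree above [t] ([resolves_contractible]).  Exactness need not
    survive when the entries are raised to the power [q], but identities do,
    because [x |-> x^q] is a ring morphism.  Let [G] be the new complex; each
    [x^q] with [x] in [P] is null-homotopic on it.

    Exactness of [G] is recovered from a regular sequence [s] of length [t] in
    [P], whose [q]-th powers form a regular sequence again ([regular_seq_exp]).
    If [x] is null-homotopic and a nonzerodivisor modulo [I], then exactness
    modulo [I + (x)] in one degree gives exactness modulo [I] in the
    neighbouring degree ([exact_mod_descent]).  Feeding in the elements of the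
    sequence one by one moves from the contraction in degree [t + 1] down to
    exactness in all degrees of [G] ([acyclicity]), so [G] resolves [R/J].  Since
    null-homotopies can be transposed, the same step, started from degree [0],
    shows that the dual complex has no cohomology below degree [t]
    ([dual_acyclicity]).

    If now [a] kills [Ext^t(R/J, R)], then multiplication by [a] on the last
    cocycles of the dual complex factors through the differential, and dual
    exactness extends this factorization degree by degree to a null-homotopy of
    [a], whose degree [0] part reads [a = h d], that is [a] lies in [J]
    ([kills_cohomology_homotopy]).  The converse is the null-homotopy of the
    elements of [J].  Both directions compare [G] with an arbitrary projective
    resolution by chain maps that are unique up to homotopy ([comparison],
    [null_homotopy]). *)

(** * Ideals and regular sequences *)

Section IdealGeneration.
Variable R : comNzRingType.
Implicit Types (I J : ideal R) (s : seq R) (x r : R).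

Lemma ideal0 I : 0 \in I. Proof. exact: (@rpred0 R^o I). Qed.

Lemma idealD I a b : a \in I -> b \in I -> a + b \in I.
Proof. exact: (@rpredD R^o I). Qed.

Lemma ideal_mulr I a b : b \in I -> a * b \in I.
Proof. exact: (@rpredZ R R^o I). Qed.

Lemma idealN I a : a \in I -> - a \in I.
Proof. by rewrite -mulN1r; apply: ideal_mulr. Qed.

Lemma idealB I a b : a \in I -> b \in I -> a - b \in I.
Proof. by move=> aI bI; rewrite idealD ?idealN. Qed.

Lemma ideal_mull I a b : a \in I -> a * b \in I.
Proof. by rewrite mulrC; apply: ideal_mulr. Qed.

Lemma mem_ideal_span (S : set R) x : S x -> x \in ideal_span S.
Proof. by move=> Sx; apply/asboolP => N; apply. Qed.

Lemma ideal_span_sub (S : set R) I :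
  (forall x, S x -> x \in I) -> {subset ideal_span S <= I}.
Proof. by move=> SI x /asboolP; apply. Qed.

Section Adjoin.
Variables (I : ideal R) (x : R).

Definition adjoin : {pred R^o} := fun r => `[< exists c, r - c * x \in I >].

Fact adjoin_closed : GRing.submod_closed adjoin.
Proof.
split=> [|a u v /asboolP[c uI] /asboolP[d vI]]; apply/asboolP.
  by exists 0; rewrite mul0r subr0 ideal0.
exists (a * c + d).
have -> : a *: u + v - (a * c + d) * x = a * (u - c * x) + (v - d * x) :> R.
  by rewrite mulrBr mulrDl opprD addrACA mulrA.
by rewrite idealD // ideal_mulr.
Qed.

HB.instance Definition _ :=
  GRing.isSubmodClosed.Build R R^o adjoin
    (GRing.submod_closed_semi adjoin_closed).

Lemma adjoinP r : reflect (exists c, r - c * x \in I) (r \in adjoin).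
Proof. exact: asboolP. Qed.

End Adjoin.

Lemma sub_adjoin I x : {subset I <= adjoin I x}.
Proof. by move=> r rI; apply/adjoinP; exists 0; rewrite mul0r subr0. Qed.

Lemma mem_adjoin I x : x \in adjoin I x.
Proof. by apply/adjoinP; exists 1; rewrite mul1r subrr ideal0. Qed.

Lemma ideal_span_rcons s x :
  ideal_span (fun y => y \in rcons s x)
    =i adjoin (ideal_span (fun y => y \in s)) x.
Proof.
move=> r; apply/idP/idP.
  apply: (ideal_span_sub (I := adjoin (ideal_span (fun y => y \in s)) x)) => y.
  rewrite /= mem_rcons inE => /orP[/eqP->|ys]; first exact: mem_adjoin.
  exact/sub_adjoin/mem_ideal_span.
case/adjoinP=> c; set b := r - _ => bI.
have -> : r = b + c * x by rewrite subrK.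
apply: idealD.
  apply: (ideal_span_sub _ bI) => y ys.
  by apply: mem_ideal_span; rewrite mem_rcons inE ys orbT.
by apply/ideal_mulr/mem_ideal_span; rewrite mem_rcons mem_head.
Qed.

Lemma ideal_span_nil : ideal_span (fun y : R => y \in [::]) =i pred1 0.
Proof.
move=> r; rewrite inE; apply/idP/eqP => [/asboolP|->]; last exact: ideal0.
have cl : GRing.submod_closed (pred1 0 : {pred R^o}).
  split=> [|a u v]; rewrite !inE // => /eqP-> /eqP->.
  by rewrite scaler0 addr0.
pose Z := HB.pack_for (ideal R) (pred1 0 : {pred R^o})
  (GRing.isSubmodClosed.Build R R^o _ (GRing.submod_closed_semi cl)).
by move=> /(_ Z (fun x => ltac:(by [])))/eqP.
Qed.

Definition nzdiv_mod I x := forall r, r * x \in I -> r \in I.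

(** Weak regularity on [R/I], by recursion on the sequence so that an induction
    can change the base ideal. *)
Fixpoint regular_mod I s :=
  if s is x :: s' then nzdiv_mod I x /\ regular_mod (adjoin I x) s' else True.

Lemma nzdiv_mod_eq I J x : I =i J -> nzdiv_mod I x -> nzdiv_mod J x.
Proof. by move=> IJ xI r; rewrite -!IJ => /xI. Qed.

Lemma adjoin_eq I J x : I =i J -> adjoin I x =i adjoin J x.
Proof.
by move=> IJ r; apply/adjoinP/adjoinP => -[c]; exists c; rewrite ?IJ // -IJ.
Qed.

Lemma regular_mod_eq I J s : I =i J -> regular_mod I s -> regular_mod J s.
Proof.
elim: s I J => //= x s IH I J IJ [xI sI]; split; first exact: nzdiv_mod_eq xI.
by apply: IH sI; apply: adjoin_eq.
Qed.

(** The hypotheses say that [0 -> R/A --x--> R/B -> R/C -> 0] is exact.  A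
    sequence that is regular on both ends is regular in the middle, because the
    quotient of such a short exact sequence by an element regular on [R/C]
    stays exact. *)
Lemma regular_mod_extension x (A B C : ideal R) s :
    (forall r, (r * x \in B) = (r \in A)) -> C =i adjoin B x ->
  regular_mod A s -> regular_mod C s -> regular_mod B s.
Proof.
elim: s A B C => //= z s IH A B C xBA CB [zA sA] [zC sC].
have zB : nzdiv_mod B z.
  move=> r rzB; have /zC : r * z \in C by rewrite CB sub_adjoin.
  rewrite CB => /adjoinP[c rc]; rewrite -[r](subrK (c * x)) idealD // xBA.
  apply: zA; rewrite -xBA mulrAC -[c * x](subKr r) mulrBl idealB //.
  exact: ideal_mull.
split=> //; apply: IH sA sC => [r|r].
  apply/adjoinP/adjoinP => -[c].
    move=> rxB; have /zC : c * z \in C.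
      rewrite CB; apply/adjoinP; exists r.
      by rewrite -opprB idealN.
    rewrite CB => /adjoinP[d cd]; exists d; rewrite -xBA mulrBl mulrAC.
    have -> : r * x - d * x * z = (r * x - c * z) + (c - d * x) * z.
      by rewrite mulrBl addrA subrK.
    by rewrite idealD // ideal_mull.
  move=> rA; exists (c * x); rewrite mulrAC -mulrBl xBA //.
apply/adjoinP/adjoinP => -[c].
  rewrite CB => /adjoinP[d rd]; exists d; apply/adjoinP; exists c.
  by rewrite addrAC.
case/adjoinP=> d rd; exists d; rewrite CB; apply/adjoinP; exists c.
by rewrite addrAC.
Qed.

Lemma nzdiv_modX I x q : nzdiv_mod I x -> nzdiv_mod I (x ^+ q).
Proof.
move=> xI; elim: q => [|q IH] r; first by rewrite expr0 mulr1.
by rewrite exprSr mulrA => /xI/IH.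
Qed.

(** The extension [0 -> R/(I, x^q) -> R/(I, x^(q+1)) -> R/(I, x) -> 0] gives the
    step from [q] to [q + 1]. *)
Lemma regular_mod_exp1 I x q s :
    (0 < q)%N -> nzdiv_mod I x -> regular_mod (adjoin I x) s ->
  regular_mod (adjoin I (x ^+ q)) s.
Proof.
case: q => // q _ xI sI; elim: q => [|q IH]; first by rewrite expr1.
apply: (regular_mod_extension (x := x) _ _ IH sI) => r.
  apply/adjoinP/adjoinP => -[c rc]; exists c.
    by apply: xI; rewrite mulrBl -mulrA -exprSr.
  by rewrite exprSr mulrA -mulrBl ideal_mull.
apply/adjoinP/adjoinP => -[c].
  move=> rI; exists c; exact: sub_adjoin.
case/adjoinP=> d; rewrite exprSr mulrA -addrA -opprD -mulrDl => rI.
by exists (c + d * x ^+ q.+1).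
Qed.

Lemma regular_mod_exp I q s :
  (0 < q)%N -> regular_mod I s -> regular_mod I [seq x ^+ q | x <- s].
Proof.
move=> q_gt0; elim: s I => //= x s IH I [xI sI]; split; first exact: nzdiv_modX.
by apply: IH; apply: regular_mod_exp1.
Qed.

(** The prefix [s0] is what makes the induction on [s] possible; regularity on
    [R] itself is the case [s0 = [::]]. *)
Lemma regular_modP s0 s :
  regular_mod (ideal_span (fun y => y \in s0)) s <->
  forall i, (i < size s)%N ->
    nzdiv_mod (ideal_span (fun y => y \in s0 ++ take i s)) s`_i.
Proof.
elim: s s0 => [|x s IH] s0 /=; first by split.
have e i : s0 ++ x :: take i s = rcons s0 x ++ take i s by rewrite cat_rcons.
split=> [[xI /(regular_mod_eq (fun r => esym (ideal_span_rcons s0 x r)))/IH sI]|h].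
  by case=> [|i] /= ilt; [rewrite cats0 | rewrite e; apply: sI].
split; first by have := h 0%N isT; rewrite /= cats0.
apply: (regular_mod_eq (ideal_span_rcons s0 x)); apply/IH => i ilt.
by rewrite -e; apply: (h i.+1).
Qed.

Lemma regular_seq_exp s q :
    (0 < q)%N -> regular_seq s -> regular_seq [seq x ^+ q | x <- s].
Proof.
move=> q_gt0 [sreg s1]; split.
  have /regular_modP/(regular_mod_exp q_gt0)/regular_modP :
    forall i, (i < size s)%N ->
      nzdiv_mod (ideal_span (fun y => y \in [::] ++ take i s)) s`_i.
    by move=> i ilt r; apply: sreg.
  by move=> h i r /h; apply.
apply: contra s1; apply: ideal_span_sub => y /mapP[x xs ->].
by case: q q_gt0 => // q _; rewrite exprS ideal_mull // mem_ideal_span.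
Qed.

End IdealGeneration.

(** * Acyclicity of complexes of free modules *)

Section ExactModulo.
Variable R : comNzRingType.
Implicit Types (I : ideal R) (x : R).

Definition mx_in I m n (A : 'M[R]_(m, n)) := forall i j, A i j \in I.

Lemma mx_inD I m n (A B : 'M[R]_(m, n)) :
  mx_in I A -> mx_in I B -> mx_in I (A + B).
Proof. by move=> AI BI i j; rewrite mxE idealD. Qed.

Lemma mx_in_mulr I m n k (A : 'M[R]_(m, n)) (B : 'M_(n, k)) :
  mx_in I A -> mx_in I (A *m B).
Proof.
move=> AI i j; rewrite mxE.
by elim/big_ind: _ => [||l _]; [exact: ideal0|exact: idealD|exact: ideal_mull].
Qed.

Lemma mx_in_nzdiv I x m n (A : 'M[R]_(m, n)) :
  nzdiv_mod I x -> mx_in I (x *: A) -> mx_in I A.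
Proof. by move=> xI AI i j; apply: xI; rewrite mulrC; have:= AI i j; rewrite mxE. Qed.

Lemma mx_in_adjoin I x m n (A : 'M[R]_(m, n)) :
  mx_in (adjoin I x) A -> exists B, mx_in I (A - x *: B).
Proof.
move=> AI; have c i j : {c | A i j - c * x \in I} by apply/cid/adjoinP.
by exists (\matrix_(i, j) sval (c i j)) => i j; rewrite !mxE mulrC (svalP (c i j)).
Qed.

Lemma mx_in0 m n (A : 'M[R]_(m, n)) :
  mx_in (ideal_span (fun y => y \in [::])) A <-> A = 0.
Proof.
split=> [AI|-> i j]; last by rewrite mxE ideal0.
by apply/matrixP => i j; have:= AI i j; rewrite ideal_span_nil mxE => /eqP.
Qed.

(** Exactness of [R^a -> R^b -> R^c] after reduction modulo [I], row vectors
    being multiplied on the right.  Several rows are treated at once so that the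
    statement applies to matrices. *)
Definition exact_mod I a b c (A : 'M[R]_(a, b)) (B : 'M_(b, c)) :=
  forall m (V : 'M_(m, b)), mx_in I (V *m B) -> exists W, mx_in I (V - W *m A).

(** If [V C = 0] modulo [I], the homotopy gives [x V = (V H') B] modulo [I], so
    [V H'] is a cycle modulo [I + (x)].  Writing it as a boundary plus [x Y] gives
    [x V = x Y B] modulo [I], and [x] can be cancelled. *)
Lemma exact_mod_descent I x a b c d (A : 'M[R]_(a, b)) (B : 'M_(b, c))
    (C : 'M_(c, d)) H H' :
    nzdiv_mod I x -> A *m B = 0 -> x%:M = C *m H + H' *m B ->
  exact_mod (adjoin I x) A B -> exact_mod I B C.
Proof.
move=> xI AB0 xE exAB m V VCI; have := exAB m (V *m H').
have VH'B : V *m H' *m B = x *: V - V *m C *m H.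
  by rewrite -mul_mx_scalar xE mulmxDr !mulmxA addrAC subrr add0r.
case=> [|U].
  rewrite VH'B => i j; rewrite mxE [X in X + _]mxE [X in _ + X]mxE.
  apply: idealB; last by apply: sub_adjoin; apply: mx_in_mulr.
  exact/ideal_mull/mem_adjoin.
case/mx_in_adjoin=> Y UY; exists Y; apply: (mx_in_nzdiv xI).
have -> : x *: (V - Y *m B) = (V *m H' - U *m A - x *: Y) *m B + V *m C *m H.
  rewrite !mulmxBl -(mulmxA U) AB0 mulmx0 subr0 VH'B -scalemxAl scalerBr.
  by rewrite addrAC subrK.
by apply: mx_inD; apply: mx_in_mulr.
Qed.

End ExactModulo.

Section FreeComplex.
Variables (R : comNzRingType) (r : nat -> nat).
Variable D : forall i, 'M[R]_(r i.+1, r i).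

(** Multiplication by [a] is null-homotopic on [... -> R^(r 1) -> R^(r 0)]. *)
Definition null_homotopic (a : R) :=
  exists H : forall i, 'M[R]_(r i, r i.+1),
    a%:M = H 0%N *m D 0%N /\
    forall i, a%:M = D i *m H i + H i.+1 *m D i.+1.

(** The identity is null-homotopic in degree [i + 1]. *)
Definition contractible_at i :=
  exists (H : 'M[R]_(r i, r i.+1)) (H' : 'M_(r i.+1, r i.+2)),
    1%:M = D i *m H + H' *m D i.+1.

Hypothesis DD : forall i, D i.+1 *m D i = 0.

Lemma contractible_exact I i :
  contractible_at i -> exact_mod I (D i.+1) (D i).
Proof.
move=> [H [H' HE]] m V VD; exists (V *m H').
have -> : V - V *m H' *m D i.+1 = V *m D i *m H.
  by rewrite -{1}[V]mulmx1 HE mulmxDr !mulmxA addrK.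
exact: mx_in_mulr.
Qed.

Variable s : seq R.
Hypothesis s_homotopic : forall x, x \in s -> null_homotopic x.
Hypothesis s_regular : regular_seq s.

Let I_ j := ideal_span (fun y => y \in take j s).

Lemma nzdiv_prefix j : (j < size s)%N -> nzdiv_mod (I_ j) s`_j.
Proof. by case: s_regular => h _ jlt r'; apply: h. Qed.

Lemma exact_mod_prefix j a b c (A : 'M[R]_(a, b)) (B : 'M_(b, c)) :
    (j < size s)%N ->
  exact_mod (I_ j.+1) A B -> exact_mod (adjoin (I_ j) s`_j) A B.
Proof.
move=> jlt exAB m V.
have e : I_ j.+1 =i adjoin (I_ j) s`_j.
  by rewrite /I_ (take_nth 0 jlt); apply: ideal_span_rcons.
have tr k l (M : 'M_(k, l)) : mx_in (I_ j.+1) M <-> mx_in (adjoin (I_ j) s`_j) M.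
  by split=> h ? ?; [rewrite -e | rewrite e].
by move=> /tr/exAB[W /tr]; exists W.
Qed.

(** The inequality [j <= k] guarantees that an element of [s] is left to pay for
    each step up, until degree [size s + 1] is reached. *)
Lemma acyclicity_mod d j k :
    (k + d = size s)%N -> (j <= k)%N -> contractible_at (size s) ->
  exact_mod (I_ j) (D k.+1) (D k).
Proof.
move=> kd jk ct; elim: d j k kd jk => [|d IH] j k.
  by rewrite addn0 => -> _; apply: contractible_exact.
move=> kd jk; have jlt : (j < size s)%N.
  by rewrite (leq_ltn_trans jk) // -kd -addSnnS leq_addr.
have /s_homotopic[H [_ HE]] := mem_nth 0 jlt.
apply: (exact_mod_descent (nzdiv_prefix jlt) (DD _) (HE k)).
by apply/exact_mod_prefix => //; apply: IH; rewrite ?addSnnS.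
Qed.

(** A form of the Peskine-Szpiro acyclicity lemma. *)
Lemma acyclicity k :
    (k <= size s)%N -> contractible_at (size s) ->
  forall m (V : 'M_(m, r k.+1)), V *m D k = 0 -> exists W, V = W *m D k.+1.
Proof.
move=> /subnKC/acyclicity_mod h /(h _ (leq0n _)) exD m V VD0.
have [|W] := exD m V; rewrite /I_ take0; first exact/mx_in0.
by move=> /mx_in0/subr0_eq; exists W.
Qed.

Lemma dual_injective_mod j m (V : 'M_(r 0%N, m)) :
  (j < size s)%N -> mx_in (I_ j) (D 0%N *m V) -> mx_in (I_ j) V.
Proof.
move=> jlt DV; apply: (mx_in_nzdiv (nzdiv_prefix jlt)).
have /s_homotopic[H [HE _]] := mem_nth 0 jlt.
rewrite -mul_scalar_mx HE -mulmxA -[_ *m _]trmxK => i i'; rewrite mxE.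
rewrite trmx_mul; apply: mx_in_mulr => {}i {}i'; rewrite mxE; exact: DV.
Qed.

(** Induction on the degree [k + 1]: a step uses up one element of [s] and lowers
    the degree by one, until it reaches degree [0], where [x = h d] makes the
    differential injective modulo [I_ j] for [j < size s]. *)
Lemma dual_acyclicity_mod j k :
    (j + k.+1 < size s)%N -> exact_mod (I_ j) (D k)^T (D k.+1)^T.
Proof.
elim: k j => [|k IH] j jk; have jlt := leq_ltn_trans (leq_addr _ _) jk.
  have /s_homotopic[H [_ /(_ 0%N)/(congr1 trmx)]] := mem_nth 0 jlt.
  rewrite linearD /= !trmx_mul tr_scalar_mx addrC => HE.
  apply: (exact_mod_descent (nzdiv_prefix jlt) (mul0mx 0 _) HE).
  apply/exact_mod_prefix => // m V VD; exists 0; rewrite mul0mx subr0.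
  rewrite addn1 in jk => i i'; rewrite -[V]trmxK mxE.
  apply: (dual_injective_mod jk) => {}i {}i'.
  rewrite -[D 0%N]trmxK -trmx_mul mxE; exact: VD.
have /s_homotopic[H [_ /(_ k.+1)/(congr1 trmx)]] := mem_nth 0 jlt.
rewrite linearD /= !trmx_mul tr_scalar_mx addrC => HE.
apply: (exact_mod_descent (A := (D k)^T) (nzdiv_prefix jlt) _ HE).
  by rewrite -trmx_mul DD trmx0.
by apply/exact_mod_prefix => //; apply: IH; rewrite addSnnS.
Qed.

Lemma dual_injective m (V : 'M_(r 0%N, m)) :
  (0 < size s)%N -> D 0%N *m V = 0 -> V = 0.
Proof.
move=> s_gt0 DV; apply/mx_in0; have := dual_injective_mod s_gt0 (V := V).
by rewrite /I_ take0; apply; apply/mx_in0.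
Qed.

Lemma dual_acyclicity k m (V : 'M_(r k.+1, m)) :
  (k.+1 < size s)%N -> D k.+1 *m V = 0 -> exists W, V = D k *m W.
Proof.
move=> klt DV; have := @dual_acyclicity_mod 0 k klt m V^T; rewrite /I_ take0.
case=> [|W /mx_in0/subr0_eq/(congr1 trmx)].
  by apply/mx_in0; rewrite -trmx_mul DV trmx0.
by rewrite trmxK trmx_mul trmxK; exists W^T.
Qed.

(** [a] annihilates the cohomology in degree [t] of the dual complex, whose
    cochains are column vectors. *)
Definition kills_cohomology t (a : R) :=
  match t return Prop with
  | 0 => forall V : 'cV_(r 0%N), D 0%N *m V = 0 -> a *: V = 0
  | k.+1 => forall V : 'cV_(r k.+1), D k.+1 *m V = 0 ->
              exists W, a *: V = D k *m W
  end.

(** With [t = size s] and [H] from the contraction, the columns of [1 - H D_t]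
    are cocycles, so [a (1 - H D_t) = D_(t-1) K].  Hence [a - K D_(t-1)] is
    annihilated by [D_(t-1)] on the left; dual exactness writes it as
    [D_(t-2) K'], and so on down to degree [0], where [a = K D_0].  For [t = 0]
    one has [a (1 - H D_0) = 0] at once. *)
Lemma kills_cohomology_homotopy a :
    contractible_at (size s) -> kills_cohomology (size s) a ->
  exists K, a%:M = K *m D 0%N.
Proof.
(* the columns of 1 - H D_t are cocycles *)
have split_cocycle t H H' : 1%:M = D t *m H + H' *m D t.+1 ->
    D t *m (1%:M - H *m D t) = 0.
  move=> HE; rewrite mulmxBr mulmx1 mulmxA.
  have -> : D t *m H = 1%:M - H' *m D t.+1 by rewrite HE addrK.
  by rewrite mulmxBl mul1mx -mulmxA DD mulmx0 subr0 subrr.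
move=> [H [H' HE]] ka; have {HE} De := split_cocycle _ _ _ HE.
case: (size s) H {H'} ka De (@dual_injective) (@dual_acyclicity) => [|k] H.
  move=> ka De _ _; exists (a *: H); set e := 1%:M - _ in De.
  suff : a *: e = 0.
    move/eqP; rewrite scalerBr scalemx1 subr_eq0 => /eqP->.
    by rewrite scalemxAl.
  apply/matrixP => i j; have /(congr1 (fun A : 'cV_ _ => A i 0)) : a *: col j e = 0.
    by apply: ka; rewrite colE mulmxA De mul0mx.
  by rewrite !mxE.
move=> /= ka De inj ex; set e := 1%:M - _ in De.
have [K aE] : exists K, a *: e = D k *m K.
  have c j : {W : 'cV_(r k) | a *: col j e = D k *m W}.
    by apply/cid/ka; rewrite colE mulmxA De mul0mx.
  exists (\matrix_(i, j) sval (c j) i 0); apply/matrixP => i j.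
  have /(congr1 (fun A : 'cV_ _ => A i 0)) := svalP (c j); rewrite !mxE => ->.
  by apply: eq_bigr => l _; rewrite mxE.
have {aE} : exists K, D k *m (a%:M - K *m D k) = 0.
  exists K; rewrite mulmxBr mulmxA -aE -scalemxAl mulmxBl mul1mx -mulmxA DD.
  by rewrite mulmx0 subr0 mul_mx_scalar subrr.
(* K lives between degrees j and j + 1 for j going down from k to 0 *)
have := leqnn k; elim: {-2}k => {K} [|j IH] jk [K DK].
  by exists K; apply/subr0_eq/inj.
case: (ex _ _ _ jk DK) => L KE; apply: IH; first exact: ltnW.
exists L; rewrite mulmxBr mulmxA -KE mulmxBl -mulmxA DD mulmx0 subr0.
by rewrite mul_mx_scalar mul_scalar_mx subrr.
Qed.

End FreeComplex.

(** * Comparison of resolutions *)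

(** The universal property of [Q] is about surjections, so a map into the image
    of [d] is lifted through the corestriction of [d] to [range_mod]. *)
Section ProjectiveLifting.
Variables (R : comNzRingType) (A B : lmodType R) (d : {linear A -> B}).

Definition range_pred : {pred B} := fun y => `[< exists x, d x = y >].

Fact range_pred_closed : GRing.submod_closed range_pred.
Proof.
split=> [|a u v /asboolP[x <-] /asboolP[y <-]]; apply/asboolP.
  by exists 0; rewrite linear0.
by exists (a *: x + y); rewrite linearP.
Qed.

HB.instance Definition _ := GRing.isSubmodClosed.Build R B range_pred
  (GRing.submod_closed_semi range_pred_closed).

Record range_mod := RangeMod { range_val :> B; _ : range_val \in range_pred }.
HB.instance Definition _ := [isSub for range_val].
HB.instance Definition _ := [Choice of range_mod by <:].
HB.instance Definition _ := [SubChoice_isSubLmodule of range_mod by <:].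

Lemma projective_lift (Q : lmodType R) (f : {linear Q -> B}) :
    projective Q -> (forall x, exists y, d y = f x) ->
  exists h : {linear Q -> A}, forall x, d (h x) = f x.
Proof.
move=> projQ fd.
have dR x : d x \in range_pred by apply/asboolP; exists x.
have fR x : f x \in range_pred by apply/asboolP/fd.
pose d' x : range_mod := Sub (d x) (dR x).
pose f' x : range_mod := Sub (f x) (fR x).
have d'_lin : linear d' by move=> a u v; apply: val_inj; rewrite linearP /= linearP.
have f'_lin : linear f' by move=> a u v; apply: val_inj; rewrite linearP /= linearP.
pose dl : {linear A -> range_mod} :=
  HB.pack d' (GRing.isLinear.Build _ _ _ _ d' d'_lin).
pose fl : {linear Q -> range_mod} :=
  HB.pack f' (GRing.isLinear.Build _ _ _ _ f' f'_lin).
have [|h hE] := projQ _ _ dl fl.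
  by move=> b; have /asboolP[x xb] := valP b; exists x; apply: val_inj.
by exists h => x; have /(congr1 val) := hE x.
Qed.

End ProjectiveLifting.

Lemma projective_rV (R : comNzRingType) n : projective 'rV[R]_n.
Proof.
move=> A B g f g_surj.
have c j : {a | g a = f (delta_mx 0 j)} by apply/cid/g_surj.
pose h (x : 'rV[R]_n) := \sum_j x 0 j *: sval (c j).
have h_lin : linear h.
  move=> a u v; rewrite /h scaler_sumr -big_split; apply: eq_bigr => j _ /=.
  by rewrite !mxE scalerDl scalerA.
pose hl : {linear 'rV[R]_n -> A} :=
  HB.pack h (GRing.isLinear.Build _ _ _ _ h h_lin).
exists hl => x; rewrite [in RHS](row_sum_delta x) !linear_sum /=.
by apply: eq_bigr => j _; rewrite !linearZ /= (svalP (c j)).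
Qed.

(** [Inv] is what makes the next step possible; it has to be carried along in
    the recursion but is of interest only at the start. *)
Lemma dependent_choice_seq (T : nat -> Type) (Inv : forall i, T i -> Prop)
    (S : forall i, T i -> T i.+1 -> Prop) :
    (exists x, Inv 0%N x) ->
    (forall i x, Inv i x -> exists2 y, S i x y & Inv i.+1 y) ->
  exists2 f : forall i, T i, Inv 0%N (f 0%N) & forall i, S i (f i) (f i.+1).
Proof.
move=> /cid[x0 x0I] next.
have step i (u : {x | Inv i x}) : {v : {x | Inv i.+1 x} | S i (sval u) (sval v)}.
  by apply/cid; case: (next i _ (svalP u)) => y uy yI; exists (exist _ y yI).
pose F := nat_rect (fun i => {x | Inv i x}) (exist _ x0 x0I)
  (fun i u => sval (step i u)).
by exists (fun i => sval (F i)) => // i; apply: (svalP (step i (F i))).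
Qed.

Section Comparison.
Variables (R : comNzRingType) (M M' : lmodType R) (Q Q' : nat -> lmodType R).
Variables (F : resolution M Q) (F' : resolution M' Q').
Hypothesis projQ : forall i, projective (Q i).

Lemma res_dd (N : lmodType R) (P : nat -> lmodType R) (G : resolution N P) i x :
  res_d G i (res_d G i.+1 x) = 0.
Proof. by apply/(res_exact G); exists x. Qed.

Lemma res_aug_d (N : lmodType R) (P : nat -> lmodType R) (G : resolution N P) x :
  res_aug G (res_d G 0%N x) = 0.
Proof. by apply/(res_exact0 G); exists x. Qed.

(** Lifts are built degree by degree; the invariant is that the current map sends
    boundaries to cycles, hence to boundaries. *)
Lemma comparison (phi : {linear M -> M'}) :
  exists2 f : forall i, {linear Q i -> Q' i},
    forall x, res_aug F' (f 0%N x) = phi (res_aug F x) &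
    forall i x, res_d F' i (f i.+1 x) = f i (res_d F i x).
Proof.
pose Inv i : {linear Q i -> Q' i} -> Prop :=
  match i with
  | 0 => fun f => forall x, res_aug F' (f x) = phi (res_aug F x)
  | j.+1 => fun f => forall x, res_d F' j (f (res_d F j.+1 x)) = 0
  end.
pose S i (f : {linear Q i -> Q' i}) (f' : {linear Q i.+1 -> Q' i.+1}) :=
  forall x, res_d F' i (f' x) = f (res_d F i x).
apply: (dependent_choice_seq (Inv := Inv) (S := S)) => [|i f fI].
  apply: (projective_lift (f := phi \o res_aug F)) => // x.
  exact: res_aug_surj.
have [x|f' f'E] := @projective_lift _ _ _ (res_d F' i) _
  (f \o res_d F i : {linear _ -> _}) (@projQ i.+1).
  case: i f fI x => [|i] f fI x; first last.
    by have /res_exact := fI x.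
  by apply/(res_exact0 F'); rewrite fI res_aug_d linear0.
exists f' => // x /=; have /= -> := f'E (res_d F i.+1 x).
by rewrite res_dd linear0.
Qed.

(** A chain map that covers the zero map.  The invariant is that
    [f_(i+1) - h_i d] takes its values in cycles. *)
Lemma null_homotopy (f : forall i, {linear Q i -> Q' i}) :
    (forall x, res_aug F' (f 0%N x) = 0) ->
    (forall i x, res_d F' i (f i.+1 x) = f i (res_d F i x)) ->
  exists2 h : forall i, {linear Q i -> Q' i.+1},
    forall x, f 0%N x = res_d F' 0%N (h 0%N x) &
    forall i x, f i.+1 x = h i (res_d F i x) + res_d F' i.+1 (h i.+1 x).
Proof.
move=> f0 fd.
pose Inv i : {linear Q i -> Q' i.+1} -> Prop :=
  match i with
  | 0 => fun h => forall x, f 0%N x = res_d F' 0%N (h x)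
  | j.+1 => fun h => forall x,
      res_d F' j.+1 (h (res_d F j.+1 x)) = f j.+1 (res_d F j.+1 x)
  end.
pose S i (h : {linear Q i -> Q' i.+1}) (h' : {linear Q i.+1 -> Q' i.+2}) :=
  forall x, f i.+1 x = h (res_d F i x) + res_d F' i.+1 (h' x).
apply: (dependent_choice_seq (Inv := Inv) (S := S)) => [|i h hI].
  have [x|h hE] := @projective_lift _ _ _ (res_d F' 0%N) _ (f 0%N) (@projQ 0%N).
    exact/(res_exact0 F').
  by exists h => x; rewrite hE.
have [x|h' h'E] := @projective_lift _ _ _ (res_d F' i.+1) _
  (f i.+1 \- (h \o res_d F i) : {linear _ -> _}) (@projQ i.+1).
  apply/(res_exact F'); rewrite /= linearB /= fd; apply/eqP.
  case: i h hI x => [|i] h hI x; rewrite subr_eq0; first by rewrite -hI.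
  by rewrite hI.
exists h' => [x|x]; first by have /= -> := h'E x; rewrite addrC subrK.
by have /= -> := h'E (res_d F i.+1 x); rewrite res_dd linear0 subr0.
Qed.

End Comparison.

(** * Finite free resolutions of cyclic modules *)

Section MatrixOfLinear.
Variable R : comNzRingType.

Lemma mulmx_row_inj m n (A B : 'M[R]_(m, n)) :
  (forall v : 'rV_m, v *m A = v *m B) -> A = B.
Proof. by move=> AB; apply/row_matrixP => i; rewrite !rowE. Qed.

Lemma rV1_eq (v : 'rV[R]_1) : v = (v 0 0)%:M.
Proof. exact: mx11_scalar. Qed.

(** The linear form on row vectors with coefficients [V]. *)
Definition col_form n (V : 'cV[R]_n) (x : 'rV[R]_n) : R^o := (x *m V) 0 0.

Fact col_form_linear n (V : 'cV[R]_n) : linear (col_form V).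
Proof. by move=> a u v; rewrite /col_form mulmxDl -scalemxAl !mxE. Qed.

HB.instance Definition _ n (V : 'cV[R]_n) :=
  GRing.isLinear.Build R 'rV[R]_n R^o *:%R (col_form V) (col_form_linear V).

Lemma linear_col_form n (l : {linear 'rV[R]_n -> R^o}) :
  exists V, forall x, l x = col_form V x.
Proof.
exists (\col_j l (delta_mx 0 j)) => x; rewrite {1}(row_sum_delta x) linear_sum.
by rewrite /col_form mxE; apply: eq_bigr => j _; rewrite linearZ mxE.
Qed.

Lemma col_form_eq n (V W : 'cV[R]_n) :
  (forall x, col_form V x = col_form W x) -> V = W.
Proof.
move=> VW; apply: mulmx_row_inj => v; rewrite [LHS]rV1_eq [RHS]rV1_eq.
by congr _%:M; apply: VW.
Qed.

End MatrixOfLinear.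

Lemma ideal_span_seq (R : comNzRingType) (s : seq R) x :
    x \in ideal_span (fun y => y \in s) ->
  exists c : 'rV_(size s), x = \sum_i c 0 i * s`_i.
Proof.
pose V := \col_(i < size s) s`_i.
have E c : col_form V c = \sum_i c 0 i * s`_i.
  by rewrite /col_form mxE; apply: eq_bigr => i _; rewrite mxE.
suff h : {subset ideal_span (fun y => y \in s) <= range_pred (col_form V)}.
  by move=> /h/asboolP[c <-]; exists c; exact: E.
apply: (ideal_span_sub (I := range_pred (col_form V))) => y ys; apply/asboolP.
have ilt : (index y s < size s)%N by rewrite index_mem.
exists (delta_mx 0 (Ordinal ilt)); rewrite /= /col_form -rowE !mxE /=.
exact: nth_index.
Qed.

Section Noetherian.
Variable R : comNzRingType.
Hypothesis noethR : noetherian R.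

(** Hilbert's argument: the first coordinates of the elements of [N] form an
    ideal; lift its generators to [N], and add generators of the part of [N]
    whose first coordinate vanishes. *)
Lemma noetherian_rV n (N : 'rV[R]_n -> Prop) :
    N 0 -> (forall a u v, N u -> N v -> N (a *: u + v)) ->
  exists k (B : 'M_(k, n)), forall v, N v <-> exists w, v = w *m B.
Proof.
elim: n N => [|n IH] N N0 NP.
  by exists 0%N, 0 => v; rewrite [v]thinmx0; split=> // _; exists 0; rewrite mul0mx.
change ('rV[R]_(1 + n) -> Prop) in (type of N).
pose I : {pred R^o} := fun x => `[< exists2 v, N v & v 0 0 = x >].
have Icl : GRing.submod_closed I.
  split=> [|a x y /asboolP[u uN <-] /asboolP[v vN <-]]; apply/asboolP.
    by exists 0; rewrite ?mxE.
  by exists (a *: u + v); [apply: NP | rewrite !mxE].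
pose J := HB.pack_for (ideal R) I
  (GRing.isSubmodClosed.Build R R^o I (GRing.submod_closed_semi Icl)).
have [s sJ] := noethR J.
have lift (i : 'I_(size s)) : {v | N v & v 0 0 = s`_i}.
  have /asboolP/cid2[v] : s`_i \in J by rewrite sJ; apply/mem_ideal_span/mem_nth.
  by exists v.
have [|a u v uN vN|k [B NB]] := IH (fun v => N (row_mx 0 v : 'rV_(1 + n))).
- by rewrite row_mx0.
- by rewrite -[0](scaler0 _ a) -[X in row_mx X](addr0 (a *: 0)) -add_row_mx
    -scale_row_mx; apply: NP.
pose U : 'M_(size s, 1 + n) := \matrix_i s2val (lift i).
have NU c : N (c *m U).
  rewrite mulmx_sum_row; elim/big_rec: _ => // i u _; rewrite rowK.
  by apply: NP; apply: (s2valP (lift i)).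
pose UB : 'M_(size s + k, 1 + n) := col_mx U (row_mx 0 B).
have UBE c w : row_mx c w *m UB = c *m U + row_mx 0 (w *m B).
  by rewrite mul_row_col mul_mx_row mulmx0.
exists (size s + k)%N, UB => v; split=> [vN|[w ->]].
  have /ideal_span_seq[c vc] : v 0 0 \in ideal_span (fun x => x \in s).
    by rewrite -sJ; apply/asboolP; exists v.
  (* subtracting c U cancels the first coordinate of v *)
  pose v' : 'rV_(1 + n) := v - c *m U.
  have v'E : v' = row_mx 0 (rsubmx v').
    rewrite -[LHS]hsubmxK; congr row_mx; apply/matrixP => i j; rewrite !ord1 !mxE.
    have -> : lshift n 0 = (0 : 'I_n.+1) :> 'I_(1 + n) by exact/val_inj.
    rewrite vc; apply/eqP; rewrite subr_eq0; apply/eqP/eq_bigr => l _.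
    by rewrite /U mxE (s2valP' (lift l)).
  have /NB[w wE] : N (row_mx 0 (rsubmx v') : 'rV_(1 + n)).
    by rewrite -v'E /v' addrC -scaleN1r; apply: NP.
  exists (row_mx c w); rewrite UBE -wE -v'E.
  by rewrite addrC subrK.
rewrite -[w]hsubmxK UBE -[_ *m U]scale1r; apply: NP => //.
by apply/NB; exists (rsubmx w).
Qed.

Lemma noetherian_kernel m n (A : 'M[R]_(m, n)) :
  exists k (B : 'M_(k, m)), forall v : 'rV_m, v *m A = 0 <-> exists w, v = w *m B.
Proof.
apply: (noetherian_rV (N := fun v => v *m A = 0)); first exact: mul0mx.
by move=> a u v uA vA; rewrite mulmxDl -scalemxAl uA vA scaler0 addr0.
Qed.

End Noetherian.

Section FreeResolution.
Variable R : comNzRingType.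

(** The ranks of a free resolution of a cyclic module: degree [0] has rank
    [1] by computation, so that no cast is needed. *)
Definition ranks (b : nat -> nat) i := if i is j.+1 then b j else 1%N.

Definition resolves (I : ideal R) b
    (D : forall i, 'M[R]_(ranks b i.+1, ranks b i)) :=
  (forall x : R, x \in I <-> exists w : 'rV_(b 0%N), x = col_form (D 0%N) w) /\
  forall i (v : 'rV_(ranks b i.+1)), v *m D i = 0 <-> exists w, v = w *m D i.+1.

(** Iterating kernels on triples (rows, columns, matrix) makes the number of
    columns of each matrix equal to the number of rows of the previous one by
    computation. *)
Lemma free_resolution (I : ideal R) : noetherian R -> exists b D, @resolves I b D.
Proof.
move=> noethR.
pose T := {m : nat & {n : nat & 'M[R]_(m, n)}}.
have ker (S : T) : {k & {B : 'M[R]_(k, projT1 S) |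
    forall v : 'rV_(projT1 S),
      v *m projT2 (projT2 S) = 0 <-> exists w, v = w *m B}}.
  have /cid[k /cid[B kB]] := noetherian_kernel noethR (projT2 (projT2 S)).
  by exists k, B.
(* next S has the rows of S as columns, by computation *)
pose next (S : T) : T := existT _ (projT1 (ker S))
  (existT _ (projT1 S) (sval (projT2 (ker S)))).
have [s sI] := noethR I.
pose S0 : T := existT _ (size s) (existT _ 1%N (\col_i s`_i)).
pose S i := iter i next S0.
pose b i := projT1 (S i).
pose D i : 'M[R]_(ranks b i.+1, ranks b i) :=
  match i with
  | 0 => \col_i s`_i
  | j.+1 => sval (projT2 (ker (S j)))
  end.
exists b, D; split=> [x|i v].
  rewrite sI; split=> [/ideal_span_seq[c ->]|[w ->]].
    by exists c; rewrite /col_form !mxE; apply: eq_bigr => i _; rewrite mxE.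
  rewrite /col_form mxE; elim/big_ind: _ => [||i _]; first exact: ideal0.
    exact: idealD.
  by rewrite mxE; apply/ideal_mulr/mem_ideal_span/mem_nth.
have := svalP (projT2 (ker (S i))) v.
by case: i v => [|i] v.
Qed.

Variables (I : ideal R) (b : nat -> nat).
Variable D : forall i, 'M[R]_(ranks b i.+1, ranks b i).
Hypothesis DI : resolves I D.

Definition cyclic_aug (x : 'rV[R]_1) : cyclic_module I := quotmod_pi I (x 0 0).

Fact cyclic_aug_linear : linear cyclic_aug.
Proof.
move=> a u v; rewrite /cyclic_aug !mxE quotmod_piD; congr (_ + _).
exact/esym/quotmod_pi_scale.
Qed.

HB.instance Definition _ :=
  GRing.isLinear.Build R 'rV[R]_1 (cyclic_module I) *:%R cyclic_aug
    cyclic_aug_linear.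

Lemma quotmod_pi_eq0 x : quotmod_pi I x = 0 <-> x \in I.
Proof.
have -> : 0 = quotmod_pi I 0 by apply/esym/(raddf0 \pi_(Quotient.quot (submod_pred I))%qT).
by rewrite quotmod_piP subr0.
Qed.

Lemma resolves_resolution :
  exists F : resolution (cyclic_module I) (fun i => 'rV[R]_(ranks b i) : lmodType R),
    forall i x, res_d F i x = x *m D i.
Proof.
have [D0 Dex] := DI.
have aug_surj y : exists x, cyclic_aug x = y.
  have [x <-] := quotmod_pi_surj y; exists (x%:M).
  by rewrite /cyclic_aug mxE eqxx.
have ex0 x : cyclic_aug x = 0 <-> exists y, mulmxr (D 0%N) y = x.
  rewrite quotmod_pi_eq0 D0; split=> [[w xw]|[w <-]]; exists w => //=.
  by rewrite [RHS]rV1_eq xw [LHS]rV1_eq.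
have ex i (x : 'rV_(ranks b i.+1)) :
    mulmxr (D i) x = 0 <-> exists y, mulmxr (D i.+1) y = x.
  by rewrite /= Dex; split=> -[w]; exists w.
pose d i : {linear 'rV[R]_(ranks b i.+1) -> 'rV[R]_(ranks b i)} := mulmxr (D i).
by exists (@Resolution R (cyclic_module I) (fun i => 'rV[R]_(ranks b i)) d
  cyclic_aug aug_surj ex0 ex).
Qed.

End FreeResolution.

Section ResolutionHomotopies.
Variables (R : comNzRingType) (I : ideal R) (b : nat -> nat).
Variable D : forall i, 'M[R]_(ranks b i.+1, ranks b i).
Hypothesis DI : resolves I D.

Lemma resolves_complex i : D i.+1 *m D i = 0.
Proof.
case: DI => _ Dex; apply: mulmx_row_inj => v; rewrite mulmxA mulmx0.
by apply/Dex; exists v.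
Qed.

Lemma mul_lin1 m n (f : {linear 'rV[R]_m -> 'rV[R]_n}) v :
  v *m lin1_mx f = f v.
Proof. exact: mul_rV_lin1. Qed.

Lemma cyclic_annihilated a (y : cyclic_module I) : a \in I -> a *: y = 0.
Proof.
move=> aI; have [x <-] := quotmod_pi_surj y.
rewrite [LHS](quotmod_pi_scale I a x) quotmod_pi_eq0; exact: ideal_mull.
Qed.

Lemma resolves_null_homotopic a : a \in I -> null_homotopic D a.
Proof.
move=> aI; have [F FE] := resolves_resolution DI.
have [x|i x|h h0 hS] := @null_homotopy _ _ _ _ _ F F
  (fun i => @projective_rV R (ranks b i))
  (fun i => a \*: idfun : {linear 'rV[R]_(ranks b i) -> 'rV[R]_(ranks b i)}).
- by rewrite /= linearZ_LR cyclic_annihilated.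
- by rewrite /= linearZ_LR.
exists (fun i => lin1_mx (h i)); split=> [|i]; apply: mulmx_row_inj => v.
  by rewrite mul_mx_scalar mulmxA mul_lin1 -FE -h0.
by rewrite mul_mx_scalar mulmxDr !mulmxA !mul_lin1 -!FE -hS.
Qed.

(** Compare with a projective resolution [Q] of length [t], forth and back.  The
    composite is homotopic to the identity, and it vanishes in degrees above
    [t]. *)
Lemma resolves_contractible t i :
    has_proj_resolution_of_length (cyclic_module I) t -> (t <= i)%N ->
  contractible_at D i.
Proof.
move=> [Q [G [projQ Q0]]] ti; have [F FE] := resolves_resolution DI.
pose projF j := @projective_rV R (ranks b j).
have [u u0 uS] := comparison F G projF idfun.
have [v v0 vS] := comparison G F projQ idfun.
have [x|j x|h _ /(_ i) hS] := @null_homotopy _ _ _ _ _ F F projF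
  (fun j => idfun \- (v j \o u j)
     : {linear 'rV[R]_(ranks b j) -> 'rV[R]_(ranks b j)}).
- by rewrite linearB /= v0 u0 subrr.
- by rewrite /= linearB vS uS.
exists (lin1_mx (h i)), (lin1_mx (h i.+1)); apply: mulmx_row_inj => x.
rewrite mulmx1 mulmxDr !mulmxA !mul_lin1 -!FE -hS /=.
by rewrite [u i.+1 x]Q0 ?ltnS // linear0 subr0.
Qed.

(** A cocycle [V] on the free resolution is pulled back along [v] to the given
    projective resolution, where [a] makes it a coboundary [w d]; pulling this
    back along [u] gives [a V] up to the homotopy between [v u] and the
    identity, which on a cocycle contributes a coboundary. *)
Lemma ann_Ext_kills_cohomology t a :
  ann_Ext (cyclic_module I) t R^o a -> kills_cohomology D t a.
Proof.
move=> [Q [G [projQ aG]]]; have [F FE] := resolves_resolution DI.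
pose projF j := @projective_rV R (ranks b j).
have [u u0 uS] := comparison F G projF idfun.
have [v v0 vS] := comparison G F projQ idfun.
have [x|j x|h h0 hS] := @null_homotopy _ _ _ _ _ F F projF
  (fun j => idfun \- (v j \o u j)
     : {linear 'rV[R]_(ranks b j) -> 'rV[R]_(ranks b j)}).
- by rewrite linearB /= v0 u0 subrr.
- by rewrite /= linearB vS uS.
have cob V : D t *m V = 0 -> coboundary G (fun x => a *: col_form V (v t x)).
  move=> DV; apply: (aG (col_form V \o v t)) => x.
  by rewrite /= -vS FE /col_form -mulmxA DV mulmx0 mxE.
have form_cocycle V : D t *m V = 0 -> forall x, col_form V (x *m D t) = 0.
  by move=> DV x; rewrite /col_form -mulmxA DV mulmx0 mxE.
have formZ n (V : 'cV_n) x : col_form (a *: V) x = a *: col_form V x.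
  by rewrite /col_form -scalemxAr mxE.
case: t cob form_cocycle {aG} => [|k] cob form_cocycle /= V DV.
  apply: col_form_eq => x; rewrite formZ.
  have {1}-> : x = v 0%N (u 0%N x) + h 0%N x *m D 0%N.
    by rewrite -FE -h0 /= addrC subrK.
  rewrite linearD /= scalerDr (cob _ DV) add0r form_cocycle //.
  by rewrite scaler0 /col_form mulmx0 mxE.
have [w wE] := cob _ DV.
have [W WE] := linear_col_form
  ((w \o u k) \+ (a \*: (col_form V \o h k)) : {linear _ -> R^o}).
exists W; apply: col_form_eq => x; rewrite formZ.
have {1}-> : x = v k.+1 (u k.+1 x) + (h k (x *m D k) + h k.+1 x *m D k.+1).
  by rewrite -!FE -hS /= addrC subrK.
rewrite !linearD /= wE uS FE form_cocycle // scaler0 addr0.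
by rewrite [RHS]/col_form mulmxA -/(col_form W (x *m D k)) -WE.
Qed.

End ResolutionHomotopies.

Lemma ann_Ext_annihilator (R : comNzRingType) (M N : lmodType R)
    (Q : nat -> lmodType R) (F : resolution M Q) a i :
    (forall j, projective (Q j)) -> (forall y : M, a *: y = 0) ->
  ann_Ext M i N a.
Proof.
move=> projQ aM; exists Q, F; split=> // f f_cocycle.
have [x|j x|h h0 hS] := @null_homotopy _ _ _ _ _ F F projQ
  (fun j => a \*: idfun : {linear Q j -> Q j}).
- by rewrite /= linearZ_LR aM.
- by rewrite /= linearZ_LR.
case: i f f_cocycle => [|i] f f_cocycle /= => [x|].
  by rewrite -linearZ; have /= -> := h0 x; apply: f_cocycle.
exists (f \o h i) => x; rewrite -linearZ /=; have /= -> := hS i x.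
by rewrite linearD f_cocycle addr0.
Qed.

(** * Image under a ring endomorphism *)

Section BaseChange.
Variables (R : comNzRingType) (phi : {rmorphism R -> R}).
Variables (r : nat -> nat) (D : forall i, 'M[R]_(r i.+1, r i)).

Definition base_change i := map_mx phi (D i).

Lemma base_change_complex :
  (forall i, D i.+1 *m D i = 0) -> forall i, base_change i.+1 *m base_change i = 0.
Proof. by move=> DD i; rewrite -map_mxM DD map_mx0. Qed.

Lemma base_change_null_homotopic a :
  null_homotopic D a -> null_homotopic base_change (phi a).
Proof.
move=> [H [H0 HS]]; exists (fun i => map_mx phi (H i)); split=> [|i].
  by rewrite -map_mxM -H0 map_scalar_mx.
by rewrite -!map_mxM -map_mxD -HS map_scalar_mx.
Qed.

Lemma base_change_contractible i :
  contractible_at D i -> contractible_at base_change i.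
Proof.
move=> [H [H' E]]; exists (map_mx phi H), (map_mx phi H').
by rewrite -!map_mxM -map_mxD -E map_mx1.
Qed.

End BaseChange.

(** Iterating the Frobenius endomorphism. *)
Lemma pow_pchar_rmorphism (R : comNzRingType) p n :
  p \in [pchar R] -> exists phi : {rmorphism R -> R}, forall x, phi x = x ^+ (p ^ n).
Proof.
move=> charR; elim: n => [|n [phi phiE]]; first by exists idfun.
exists (pFrobenius_aut charR \o phi) => x.
by rewrite /= phiE pFrobenius_autE expnSr exprM.
Qed.

(** Perfection of [P] enters as a sequence [s] in [P] whose size bounds the
    length of a projective resolution of [R/P].  The ideal [J] generated by
    [phi(P)] is a Frobenius power of [P] when [phi] is an iterate of the
    Frobenius endomorphism. *)
Section EndomorphismImage.
Variables (R : comNzRingType) (P : ideal R) (phi : {rmorphism R -> R}).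
Variable s : seq R.
Hypothesis noethR : noetherian R.
Hypothesis pdP : has_proj_resolution_of_length (cyclic_module P) (size s).
Hypothesis sP : {subset s <= P}.
Hypothesis s_regular : regular_seq [seq phi x | x <- s].

Let J : ideal R := ideal_span (fun y => exists2 x, x \in P & y = phi x).

Section FromResolution.
Variables (b : nat -> nat) (D : forall i, 'M[R]_(ranks b i.+1, ranks b i)).
Hypothesis DP : resolves P D.

Let G := base_change phi D.

Let s_homotopic x : x \in [seq phi x | x <- s] -> null_homotopic G x.
Proof.
move=> /mapP[y ys ->]; apply/base_change_null_homotopic.
exact/(resolves_null_homotopic DP)/sP.
Qed.

Let GG i : G i.+1 *m G i = 0.
Proof. exact/base_change_complex/(resolves_complex DP). Qed.

Let G_contractible i : (size s <= i)%N -> contractible_at G i.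
Proof.
by move=> si; apply/base_change_contractible/(resolves_contractible DP pdP si).
Qed.

(** In degrees up to [size s] exactness comes from the regular sequence, beyond
    it from the contraction. *)
Lemma base_change_resolves : resolves J G.
Proof.
have [DP0 Dex] := DP; split=> [x|i v].
  split=> [|[w ->]].
    suff h : {subset J <= range_pred (col_form (G 0%N))}.
      by move=> /h/asboolP[w <-]; exists w.
    apply: (ideal_span_sub (I := range_pred _)) => {}x [y /DP0[w ->] ->].
    apply/asboolP; exists (map_mx phi w).
    by rewrite /= /col_form -map_mxM mxE.
  rewrite /col_form mxE; elim/big_ind: _ => [||i _]; first exact: ideal0.
    exact: idealD.
  rewrite mxE; apply/ideal_mulr/mem_ideal_span; exists (D 0%N i 0) => //.
  by apply/DP0; exists (delta_mx 0 i); rewrite /col_form -rowE mxE.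
split=> [vG|[w ->]]; last by rewrite -mulmxA GG mulmx0.
have [lti|lei] := ltnP i (size s); last first.
  have [|w] := contractible_exact (I := ideal_span (fun y => y \in [::]))
    (G_contractible lei) (V := v).
    exact/mx_in0.
  by move=> /mx_in0/subr0_eq; exists w.
by apply: (acyclicity GG s_homotopic s_regular _ _ vG); rewrite size_map //;
  [exact: ltnW | exact: G_contractible].
Qed.

Lemma ann_Ext_base_change a : ann_Ext (cyclic_module J) (size s) R^o a -> a \in J.
Proof.
move=> /(ann_Ext_kills_cohomology base_change_resolves) ka.
have [G0 _] := base_change_resolves; apply/G0.
have [||K aK] := @kills_cohomology_homotopy _ _ G GG _ s_homotopic s_regular a.
- by rewrite size_map; apply: G_contractible.
- by rewrite size_map.
by exists K; rewrite /col_form -aK mxE eqxx.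
Qed.

End FromResolution.

Lemma ann_Ext_endomorphism a :
  ann_Ext (cyclic_module J) (size s) R^o a <-> a \in J.
Proof.
have [b [D DP]] := free_resolution P noethR; split=> [|aJ].
  exact: (ann_Ext_base_change DP).
have [F _] := resolves_resolution (base_change_resolves DP).
apply: (ann_Ext_annihilator _ F) => [j|y]; first exact: projective_rV.
exact: cyclic_annihilated.
Qed.

End EndomorphismImage.

Lemma has_grade_uniq (R : comNzRingType) (I : ideal R) g g' :
  has_grade I g -> has_grade I g' -> g = g'.
Proof.
move=> [[s [sr sI <-]] maxg] [[s' [s'r s'I <-]] maxg'].
by apply/eqP; rewrite eqn_leq maxg' // maxg.
Qed.

Lemma has_pd_uniq (R : comNzRingType) (M : lmodType R) t t' :
  has_pd M t -> has_pd M t' -> t = t'.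
Proof.
by move=> [lt mint] [lt' mint']; apply/eqP; rewrite eqn_leq mint // mint'.
Qed.

Theorem proposition4p5 (R : comNzRingType) (p : nat) (P : ideal R) (t g n : nat)
    (noethR : noetherian R) (localR : local_ring R) (charR : p \in [pchar R])
    (primeP : prime_ideal P) (perfP : perfect_ideal P)
    (pdP : has_pd (cyclic_module P) t) (gradeP : has_grade P g)
    (q := (p ^ n)%N)
    (beta := betti (cyclic_module P)) :
  [\/ (beta (t%:Z - 1))%:Z - (beta t%:Z)%:Z + 1 = g%:Z,
      beta t%:Z = beta (t%:Z - 1) |
      beta t%:Z = 1%N] ->
  forall a : R, annExt_grade (frobenius_power P q) a <-> a \in frobenius_power P q.
Proof.
move=> _ a.
have [phi phiE] := pow_pchar_rmorphism n charR.
have q_gt0 : (0 < q)%N.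
  by rewrite expn_gt0 prime_gt0 // (pcharf_prime charR).
have gradePt : has_grade P t.
  by case: perfP => t' /(has_pd_uniq pdP) <-.
have [[s [s_regular sP s_size]] s_max] := gradePt.
have phi_regular : regular_seq [seq phi x | x <- s].
  by rewrite (eq_map phiE); apply: regular_seq_exp.
have gradeJ : has_grade (frobenius_power P q) t.
  split=> [|s' s'_regular s'J].
    exists [seq x ^+ q | x <- s]; split; rewrite ?size_map //.
      exact: regular_seq_exp.
    by move=> _ /mapP[x /sP xP ->]; apply: mem_ideal_span; exists x.
  apply: s_max => // x /s'J; apply: ideal_span_sub => _ [y yP ->].
  by case: (q) q_gt0 => // k _; rewrite exprS ideal_mull.
have JE : frobenius_power P q = ideal_span (fun y => exists2 x, x \in P & y = phi x).
  congr ideal_span; apply/funext => y; apply/propext.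
  by split=> -[x xP ->]; exists x; rewrite ?phiE.
have [pdt _] := pdP; rewrite -s_size in pdt gradeJ.
have annJ := ann_Ext_endomorphism noethR pdt sP phi_regular a; rewrite -JE in annJ.
rewrite -annJ; split=> [[g' gradeJ']|]; last by exists (size s).
by rewrite (has_grade_uniq gradeJ' gradeJ).
Qed.
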